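(* Let $\mathfrak{P}=\langle S,\mathcal{L}\rangle$ be a projective space of dimension at least $3$ and let $\mathcal{W}\subset S$ be a set of points whose index $\lambda=\mathrm{ind}_{\mathfrak{P}}(\mathcal{W})$ is a positive integer, such that every line of $\mathfrak{P}$ has at least $2\lambda+2$ points. Then both $\mathfrak{P}$ and $\mathcal{W}$ can be recovered in the complement $\mathfrak{D}_{\mathfrak{P}}(\mathcal{W})$; that is, the structure $\langle S,\mathcal{L},\in,\mathcal{W}\rangle$ is definable in terms of the incidence structure $\mathfrak{D}_{\mathfrak{P}}(\mathcal{W})$.
   Context: Lines are regarded as sets of points. Points of $\mathcal{W}$ are called improper, points of $S\setminus\mathcal{W}$ proper. Index: for an integer $\lambda\ge 0$, $\mathrm{ind}_{\mathfrak{P}}(\mathcal{W})=\lambda$ iff there is a line with exactly $\lambda$ points in $\mathcal{W}$ and every line either has at most $\lambda$ points in $\mathcal{W}$ or is contained in $\mathcal{W}$. Complement: $\mathfrak{D}_{\mathfrak{P}}(\mathcal{W})=\langle S_{\mathcal{W}},\mathcal{L}_{\mathcal{W}}\rangle$, where $S_{\mathcal{W}}=S\setminus\mathcal{W}$ and $\mathcal{L}_{\mathcal{W}}=\{k\in\mathcal{L}: k\not\subseteq\mathcal{W}\}$, with incidence $\in$ restricted to $S_{\mathcal{W}}\times\mathcal{L}_{\mathcal{W}}$. It is regarded as a two-sorted structure (points, lines) with the incidence relation between proper points and proper lines only. Definable (recoverable) in the complement: constructible purely in terms of the points, lines and incidence of the complement. Precisely, there are parameter-free formulas in the language of point-line incidence,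 in variables for points, lines and sets of lines of the complement (quantification over all of these being allowed), the formulas not depending on the particular $\mathfrak{P}$ and $\mathcal{W}$, which define sorts (consisting of tuples of such objects, possibly modulo a definable equivalence relation) and relations of a structure isomorphic to $\langle S,\mathcal{L},\in,\mathcal{W}\rangle$, by an isomorphism which is the identity on proper points and on lines in $\mathcal{L}_{\mathcal{W}}$. *)

(* Defs.v *)
From HB Require Import structures.
From mathcomp Require Import all_boot.
From mathcomp Require Import boolp classical_sets functions cardinality.

Set Implicit Arguments.
Unset Strict Implicit.
Unset Printing Implicit Defensive.

Local Open Scope classical_set_scope.
Local Open Scope card_scope.

(* A point-line geometry is a type S of points with a set L of lines, each of
   which is a set of points. *)

Definition veblen (S : Type) (L : set (set S)) : Prop :=
  forall (p a b c d : S) (k l m n : set S),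
    L k -> L l -> L m -> L n -> k <> l ->
    k p -> k a -> k b -> l p -> l c -> l d ->
    p <> a -> p <> b -> p <> c -> p <> d ->
    m a -> m c -> n b -> n d ->
    exists x : S, m x /\ n x.

Definition projective_space (S : Type) (L : set (set S)) : Prop :=
  [/\ forall a b : S, a <> b -> exists! k : set S, [/\ L k, k a & k b],
      forall k : set S, L k -> `I_3 #<= k
    & veblen L].

Definition subspace (S : Type) (L : set (set S)) (A : set S) : Prop :=
  forall (k : set S) (a b : S),
    L k -> k a -> k b -> A a -> A b -> a <> b -> k `<=` A.

Definition span (S : Type) (L : set (set S)) (A : set S) : set S :=
  smallest (subspace L) A.

(* The dimension is one less than the least cardinality of a generating set;
   infinite dimension is included. *)
Definition dim_at_least (S : Type) (L : set (set S)) (n : nat) : Prop :=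
  forall A : set S, span L A = setT -> `I_n.+1 #<= A.

Definition has_index (S : Type) (L : set (set S)) (W : set S) (lambda : nat) :
    Prop :=
  (exists2 k : set S, L k & (k `&` W #= `I_lambda)) /\
  (forall k : set S, L k -> (k `&` W #<= `I_lambda) \/ k `<=` W).

(* Abstract two-sorted incidence structures: formulas are evaluated in these, so
   they have no access to the ambient space. *)
Record incidence_structure : Type := IncidenceStructure {
  ipoint : Type;
  iline : Type;
  incident : ipoint -> iline -> Prop }.

Definition proper_points (S : Type) (W : set S) : set S := ~` W.

Definition proper_lines (S : Type) (L : set (set S)) (W : set S) :
    set (set S) :=
  [set k | L k /\ ~ (k `<=` W)].

Definition complement (S : Type) (L : set (set S)) (W : set S) :
    incidence_structure :=
  @IncidenceStructure (set_type (proper_points W)) (set_type (proper_lines L W))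
    (fun p k => (val k : set S) (val p)).

Inductive isort : Type := Pt | Ln | LnSet.

Definition isort_eqb (s t : isort) : bool :=
  match s, t with
  | Pt, Pt | Ln, Ln | LnSet, LnSet => true
  | _, _ => false
  end.

Lemma isort_eqP : Equality.axiom isort_eqb.
Proof. by case; case; constructor. Qed.

HB.instance Definition _ := hasDecEq.Build isort isort_eqP.

Definition carrier (M : incidence_structure) (s : isort) : Type :=
  match s with
  | Pt => ipoint M
  | Ln => iline M
  | LnSet => set (iline M)
  end.

(* The shape of a tuple, and equally a context of free variables; variables are
   typed de Bruijn indices into the context. *)
Definition tshape : Type := seq isort.

Inductive var : tshape -> isort -> Type :=
| VarO (G : tshape) (s : isort) : var (s :: G) s
| VarS (G : tshape) (s t : isort) : var G s -> var (t :: G) s.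

(* [form G] is the type of formulas whose free variables are among those of G;
   in particular there are no parameters. *)
Inductive form : tshape -> Type :=
| FEq (G : tshape) (s : isort) : var G s -> var G s -> form G
| FInc (G : tshape) : var G Pt -> var G Ln -> form G
| FMem (G : tshape) : var G Ln -> var G LnSet -> form G
| FFalse (G : tshape) : form G
| FNot (G : tshape) : form G -> form G
| FAnd (G : tshape) : form G -> form G -> form G
| FOr (G : tshape) : form G -> form G -> form G
| FImp (G : tshape) : form G -> form G -> form G
| FAll (G : tshape) (s : isort) : form (s :: G) -> form G
| FEx (G : tshape) (s : isort) : form (s :: G) -> form G.

Fixpoint tup (M : incidence_structure) (G : tshape) : Type :=
  match G with
  | [::] => unit
  | s :: G' => (carrier M s * tup M G')%type
  end.

Fixpoint tup_cat (M : incidence_structure) (G H : tshape) :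
    tup M G -> tup M H -> tup M (G ++ H) :=
  match G return tup M G -> tup M H -> tup M (G ++ H) with
  | [::] => fun _ v => v
  | s :: G' => fun u v => (u.1, tup_cat u.2 v)
  end.

Fixpoint lookup (M : incidence_structure) (G : tshape) (s : isort)
    (x : var G s) : tup M G -> carrier M s :=
  match x in var G0 s0 return tup M G0 -> carrier M s0 with
  | VarO _ _ => fun e => e.1
  | VarS _ _ _ y => fun e => lookup y e.2
  end.

(* Set variables range over all sets of lines (full semantics). *)
Fixpoint sat (M : incidence_structure) (G : tshape) (f : form G) :
    tup M G -> Prop :=
  match f in form G0 return tup M G0 -> Prop with
  | FEq _ _ x y => fun e => lookup x e = lookup y e
  | FInc _ x y => fun e => incident (lookup x e) (lookup y e)
  | FMem _ x y => fun e => (lookup y e : set (iline M)) (lookup x e)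
  | FFalse _ => fun _ => False
  | FNot _ g => fun e => ~ sat g e
  | FAnd _ g h => fun e => sat g e /\ sat h e
  | FOr _ g h => fun e => sat g e \/ sat h e
  | FImp _ g h => fun e => sat g e -> sat h e
  | FAll _ s g => fun e => forall a : carrier M s, @sat M (s :: _) g (a, e)
  | FEx _ s g => fun e => exists a : carrier M s, @sat M (s :: _) g (a, e)
  end.

(* A scheme of formulas defining a structure with a point sort, a line sort, an
   incidence relation and a distinguished set of points. The elements of either
   sort are represented by tuples of finitely many shapes (the values of the
   formula families at other shapes are never used); several shapes are needed
   as each sort contains the points, resp. lines, of the complement themselves
   along with the recovered ones. *)
Record interpretation : Type := Interpretation {
  pt_shapes : seq tshape;
  ln_shapes : seq tshape;
  pt_dom : forall G : tshape, form G;
  ln_dom : forall G : tshape, form G;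
  pt_eqv : forall G H : tshape, form (G ++ H);
  ln_eqv : forall G H : tshape, form (G ++ H);
  inc_rel : forall G H : tshape, form (G ++ H);
  set_rel : forall G : tshape, form G }.

Definition code (M : incidence_structure) : Type := {G : tshape & tup M G}.

Definition pt_code (M : incidence_structure) (p : ipoint M) : code M :=
  existT (tup M) [:: Pt] (p, tt).

Definition ln_code (M : incidence_structure) (k : iline M) : code M :=
  existT (tup M) [:: Ln] (k, tt).

Definition holds1 (M : incidence_structure) (f : forall G : tshape, form G)
    (c : code M) : Prop :=
  sat (f (projT1 c)) (projT2 c).

Definition holds2 (M : incidence_structure)
    (f : forall G H : tshape, form (G ++ H)) (c d : code M) : Prop :=
  sat (f (projT1 c) (projT1 d)) (tup_cat (projT2 c) (projT2 d)).

Definition pt_codes (I : interpretation) (M : incidence_structure) :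
    set (code M) :=
  [set c | projT1 c \in pt_shapes I /\ holds1 (pt_dom I) c].
Arguments pt_codes : clear implicits.

Definition ln_codes (I : interpretation) (M : incidence_structure) :
    set (code M) :=
  [set c | projT1 c \in ln_shapes I /\ holds1 (ln_dom I) c].
Arguments ln_codes : clear implicits.

(* The structure defined by I in the complement is isomorphic to (S, L, in, W),
   by an isomorphism that is the identity on proper points and lines. As usual
   for interpretations, the isomorphism from the quotients by pt_eqv and ln_eqv
   is given by the maps phi and psi it induces on representatives. *)
Definition recovers (I : interpretation) (S : Type) (L : set (set S))
    (W : set S) : Prop :=
  let M := complement L W in
  exists (phi : code M -> S) (psi : code M -> set S),
    (phi @` pt_codes I M = setT /\ psi @` ln_codes I M = L) /\
    (forall c d : code M, pt_codes I M c -> pt_codes I M d ->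
       holds2 (pt_eqv I) c d <-> phi c = phi d) /\
    (forall c d : code M, ln_codes I M c -> ln_codes I M d ->
       holds2 (ln_eqv I) c d <-> psi c = psi d) /\
    (forall c d : code M, pt_codes I M c -> ln_codes I M d ->
       holds2 (inc_rel I) c d <-> psi d (phi c)) /\
    (forall c : code M, pt_codes I M c ->
       holds1 (set_rel I) c <-> W (phi c)) /\
    (forall p : ipoint M, pt_codes I M (pt_code p) /\
       phi (pt_code p) = val p) /\
    (forall k : iline M, ln_codes I M (ln_code k) /\
       psi (ln_code k) = val k).

(* Main.v *)
Require Import Defs.
From mathcomp Require Import all_boot.
From mathcomp Require Import boolp classical_sets functions cardinality.

(** The improper points, the improper lines and the incidences involving them
    are described by first-order formulas about the proper points and lines.

    A proper line has at most [lambda] improper points, hence at least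
    [lambda + 2] proper ones.  So if a perspectivity with a proper line [k] as
    domain and a proper line [l] as range has centre [p] off both, some proper
    point of [k] other than a prescribed one goes to a proper point of [l]:
    otherwise [k] would be covered by its improper points, by the points going
    to improper points of [l] and by the prescribed point, at most
    [2 * lambda + 1] points in all ([proper_perspectivity]).  All
    configurations below are found in the complement by this count.

    Improper points.  Two distinct proper lines without common proper point
    meet in an improper point iff they are coplanar, and they are coplanar iff
    two lines through one further proper point cross both of them properly
    ([parallelP]).  Such a pair of lines encodes its common point.

    Pencils.  Let [k], [l] encode [w].  Three lines that meet pairwise are
    concurrent or coplanar.  A line [m'] meeting [k] and [l] improperly lies
    outside their plane iff no line crosses all three properly, and then it
    passes through [w].  As the dimension is at least 3, such an [m'] exists;
    a proper line [m] sharing improper points with [k], [l] and [m'] cannot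
    avoid [w], since otherwise [m] and with it [m'] would lie in the plane
    of [k] and [l] ([in_pencilP]).

    Improper lines.  A line inside [W] is encoded by two of its points [w1],
    [w2], given by pairs of proper lines; that the join of [w1] and [w2] is
    improper means that no proper line belongs to both pencils.  A third
    improper point [w3] is on this join iff the lines joining any proper
    point [p] to [w1], [w2], [w3] have a common proper transversal off [p]
    ([seen_collinearP]).

    The formulas saying all this make up [recovery]; evaluating them on codes
    of points and lines gives the isomorphism ([recovery_recovers]). *)

Set Implicit Arguments.
Unset Strict Implicit.
Unset Printing Implicit Defensive.

Local Open Scope classical_set_scope.
Local Open Scope card_scope.

(** * Cardinality comparisons and choice *)

Lemma card_le_rel (T U : Type) (A : set T) (B : set U) (R : T -> U -> Prop) :
  (forall a, A a -> exists b, B b /\ R a b) ->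
  (forall a a' b, A a -> A a' -> R a b -> R a' b -> a = a') ->
  A #<= B.
Proof.
move=> tot inj.
have /choice[f fP] : forall a : set_type A, exists b, B b /\ R (val a) b.
  by move=> [a Aa] /=; apply/tot/set_mem.
apply: (@card_le_trans _ _ _ (f @` setT)); last first.
  by apply: subset_card_le => _ [a _ <-]; case: (fP a).
rewrite -(card_le_eql (card_setT A)).
have /card_eqPle[//] : [set: set_type A] #= f @` setT.
rewrite card_eq_sym; apply: inj_card_eq => -[a Aa] [a' Aa'] _ _ ff.
apply: val_inj => /=; apply: (inj a a' (f (exist _ a Aa))).
- exact: set_mem.
- exact: set_mem.
- by case: (fP (exist _ a Aa)).
- by rewrite ff; case: (fP (exist _ a' Aa')).
Qed.

Lemma card_le_setU (T : Type) (A B : set T) (m n : nat) :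
  A #<= `I_m -> B #<= `I_n -> A `|` B #<= `I_(m + n).
Proof.
move=> /pcard_leP[f] /pcard_leP[g].
have fI : set_inj A f by exact: inj.
have gI : set_inj B g by exact: inj.
have fl : set_fun A `I_m f by exact: funS.
have gl : set_fun B `I_n g by exact: funS.
pose R x i := (A x /\ i = f x) \/ (~ A x /\ i = m + g x).
apply: (@card_le_rel _ _ _ _ R).
  move=> x ABx; have [Ax|nAx] := pselect (A x).
    by exists (f x); split; [rewrite /= ltn_addr ?fl | left].
  have Bx : B x by case: ABx.
  by exists (m + g x); split; [rewrite /= ltn_add2l gl | right].
move=> x y i ABx ABy [[Ax ->]|[nAx ->]] [[Ay e]|[nAy e]].
- by apply: fI => //; exact: mem_set.
- by move: (fl _ Ax); rewrite /= e -[ltnRHS]addn0 ltn_add2l.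
- by move: (fl _ Ay); rewrite /= -e -[ltnRHS]addn0 ltn_add2l.
- by apply: gI; [apply: mem_set; case: ABx | apply: mem_set; case: ABy
    | apply: (addnI e)].
Qed.

Lemma card_set1_le (T : Type) (a : T) : [set a] #<= `I_1.
Proof. by have /card_eqPle[] := @card_set1 _ a. Qed.

Lemma choose_on (C T : Type) (t0 : T) (D : C -> Prop) (R : C -> T -> Prop) :
  (forall c, D c -> exists t, R c t) -> exists f, forall c, D c -> R c (f c).
Proof.
move=> tot; have /choice[f fP] : forall c, exists t, D c -> R c t.
  move=> c; have [/tot[t Rct]|nDc] := pselect (D c); first by exists t.
  by exists t0.
by exists f.
Qed.

(** * Proper lines *)

Section Recovery.

Variables (S : Type) (L : set (set S)) (W : set S) (lambda : nat).
Hypothesis projL : projective_space L.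
Hypothesis dim3 : dim_at_least L 3.
Hypothesis indexW : has_index L W lambda.
Hypothesis lambda_gt0 : (0 < lambda)%N.
Hypothesis thick : forall k : set S, L k -> `I_(2 * lambda + 2) #<= k.

Implicit Types (k l m n : set S) (a b c d p q w : S).

Lemma line_eq k l a b : L k -> L l -> a <> b ->
  k a -> k b -> l a -> l b -> k = l.
Proof.
case: projL => join _ _ Lk Ll ab ka kb la lb.
by have [j [_ U]] := join a b ab; rewrite -(U k) // -(U l).
Qed.

Lemma join_line a b : a <> b -> exists k, [/\ L k, k a & k b].
Proof. by case: projL => join _ _ /join [k [? _]]; exists k. Qed.

Lemma proper_line_point k a : L k -> k a -> ~ W a -> proper_lines L W k.
Proof. by move=> Lk ka nWa; split=> // /(_ a ka). Qed.

Lemma proper_line_has_point k :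
  proper_lines L W k -> exists2 a, k a & ~ W a.
Proof.
move=> [Lk nk]; apply: contrapT => nex; apply: nk => a ka.
by apply: contrapT => nWa; apply: nex; exists a.
Qed.

Lemma proper_line_index k : proper_lines L W k -> k `&` W #<= `I_lambda.
Proof. by move=> [Lk nk]; case: indexW => _ /(_ k Lk) []. Qed.

Lemma exists_proper_point : exists a, ~ W a.
Proof.
have [k Lk /card_eqPle [kW _]] := indexW.1.
apply: contrapT => all_W.
have /thick k_big := Lk.
have kWk : k `<=` k `&` W.
  by move=> a ka; split=> //; apply: contrapT => ?; apply: all_W; exists a.
have := card_le_trans k_big (card_le_trans (subset_card_le kWk) kW).
by rewrite card_le_II leqNgt mul2n -addnn -addnA -[ltnLHS]addn0 ltn_add2l addn2.
Qed.

Lemma line_not_covered k (B : set S) (n : nat) : L k ->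
  B #<= `I_n -> (n < 2 * lambda + 2)%N -> exists2 c, k c & ~ B c.
Proof.
move=> Lk Bn n_small; apply: contrapT => cov.
have kB : k `<=` B.
  by move=> c kc; apply: contrapT => nBc; apply: cov; exists c.
have := card_le_trans (thick Lk) (card_le_trans (subset_card_le kB) Bn).
by rewrite card_le_II leqNgt n_small.
Qed.

(** At most [lambda + 2] points are to be avoided, which is less than
    [2 * lambda + 2] because [lambda] is positive. *)
Lemma another_proper_point k a b : proper_lines L W k ->
  exists c, [/\ k c, ~ W c, c <> a & c <> b].
Proof.
move=> pk; have [Lk _] := pk.
have B_small := card_le_setU (card_le_setU (proper_line_index pk)
  (card_set1_le a)) (card_set1_le b).
have [|c kc nBc] := line_not_covered Lk B_small.
  by rewrite mul2n -addnn -!addnA ltn_add2l -[(1 + 1)%N]add0n ltn_add2r.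
exists c; split=> //.
- by move=> Wc; apply: nBc; left; left.
- by move=> e; apply: nBc; left; right.
- by move=> e; apply: nBc; right.
Qed.

(** The thickness [2 * lambda + 2] is exactly what is needed: the improper points of
    [k], the proper points that the perspectivity sends into [W], which inject
    into the improper points of [l], and [c0] are at most [2 * lambda + 1].
    The last hypothesis replaces coplanarity of [p], [k] and [l]. *)
Lemma proper_perspectivity k l p c0 :
  proper_lines L W k -> proper_lines L W l -> ~ k p -> ~ l p ->
  (forall c, k c -> ~ W c -> c <> c0 ->
     exists d m, [/\ L m, m p, m c, m d & l d]) ->
  exists c d m, [/\ k c, ~ W c & c <> c0] /\ [/\ l d & ~ W d] /\
    [/\ L m, m p, m c & m d].
Proof.
move=> pk pl nkp nlp persp; have [Lk _] := pk; have [Ll _] := pl.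
pose A := [set c | [/\ k c, ~ W c & c <> c0]].
have [allW|ex] := pselect (forall c d m, A c -> l d -> L m -> m p -> m c ->
    m d -> W d); last first.
  apply: contrapT => nex; apply: ex => c d m [? ? ?] ? ? ? ? ?.
  by apply: contrapT => ?; apply: nex; exists c, d, m.
have A_small : A #<= `I_lambda.
  apply: card_le_trans (proper_line_index pl).
  apply: (@card_le_rel _ _ _ _
    (fun c d => l d /\ exists m, [/\ L m, m p, m c & m d])).
    move=> c Ac; have [kc nWc cc0] := Ac.
    have [d [m [Lm mp mc md ld]]] := persp c kc nWc cc0.
    by exists d; split; [split=> //; apply: (allW c d m) | split=> //; exists m].
  move=> c c' d [kc _ _] [kc' _ _] [ld [m [Lm mp mc md]]]
    [_ [m' [Lm' mp' mc' md']]].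
  apply: contrapT => cc'; apply: nkp.
  have pd : p <> d by move=> e; apply: nlp; rewrite e.
  have mm' := line_eq Lm Lm' pd mp md mp' md'.
  by rewrite -mm' in mc'; rewrite (line_eq Lk Lm cc' kc kc' mc mc').
have B_small := card_le_setU (card_le_setU (proper_line_index pk) A_small)
  (card_set1_le c0).
have [|c kc nBc] := line_not_covered Lk B_small.
  by rewrite mul2n -addnn ltn_add2l.
case: nBc; have [Wc|nWc] := pselect (W c); first by left; left.
by have [->|cc0] := pselect (c = c0); [right | left; right].
Qed.

(** * Recognising a common improper point *)

Definition meets_properly k l := exists a, [/\ ~ W a, k a & l a].

(** Two lines through a point off [k] and [l] that cross both of them span a
    plane containing [k] and [l]: the configuration of Veblen's axiom. *)
Definition doubly_crossed k l := exists p m1 m2,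
  [/\ ~ W p, proper_lines L W m1, proper_lines L W m2 & m1 <> m2] /\
  [/\ m1 p, m2 p, ~ k p & ~ l p] /\
  [/\ meets_properly m1 k, meets_properly m1 l, meets_properly m2 k
    & meets_properly m2 l].

Definition parallel k l :=
  [/\ k <> l, ~ meets_properly k l & doubly_crossed k l].

Lemma veblenL : veblen L. Proof. by case: projL. Qed.

(** If the lines are doubly crossed, Veblen's axiom makes them meet.
    Conversely, let them meet in [w], and take a proper point [p] on the join
    of proper points [a] of [k] and [b] of [l].  The join is the first crossing
    line; the perspectivity from [p], with [a] excluded, gives the second. *)
Lemma parallelP k l : proper_lines L W k -> proper_lines L W l ->
  parallel k l <-> k <> l /\ exists w, [/\ W w, k w & l w].
Proof.
move=> pk pl; have [Lk _] := pk; have [Ll _] := pl; split.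
  move=> [kl nm [p [m1 [m2 [[nWp [Lm1 _] [Lm2 _] m12] [[m1p m2p nkp nlp]]]]]]].
  move=> [[a [_ m1a ka]] [b [_ m1b lb]] [c [_ m2c kc]] [d [_ m2d ld]]].
  have kN x : k x -> p <> x by move=> kx e; apply: nkp; rewrite e.
  have lN x : l x -> p <> x by move=> lx e; apply: nlp; rewrite e.
  have [w [kw lw]] := veblenL Lm1 Lm2 Lk Ll m12 m1p m1a m1b m2p m2c m2d
    (kN a ka) (lN b lb) (kN c kc) (lN d ld) ka kc lb ld.
  by split=> //; exists w; split=> //; apply: contrapT => nWw; apply: nm; exists w.
move=> [kl [w [Ww kw lw]]].
have nm : ~ meets_properly k l.
  move=> [a [nWa ka la]]; apply: kl; apply: (@line_eq _ _ w a) => // e.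
  by apply: nWa; rewrite -e.
have [a ka nWa] := proper_line_has_point pk.
have [b lb nWb] := proper_line_has_point pl.
have ab : a <> b by move=> e; apply: nm; exists a; rewrite {3}e.
have aw : a <> w by move=> e; apply: nWa; rewrite e.
have bw : b <> w by move=> e; apply: nWb; rewrite e.
have [m1 [Lm1 m1a m1b]] := join_line ab.
have pm1 := proper_line_point Lm1 m1a nWa.
have [p [m1p nWp pa pb]] := another_proper_point a b pm1.
have nkb : ~ k b by move=> kb; apply: nm; exists b.
have nla : ~ l a by move=> la; apply: nm; exists a.
have nkp : ~ k p.
  by move=> kp; apply: nkb; rewrite (line_eq Lk Lm1 pa).
have nlp : ~ l p.
  by move=> lp; apply: nla; rewrite (line_eq Ll Lm1 pb).
have m1k : m1 <> k by move=> e; apply: nkp; rewrite -e.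
(* Veblen's axiom at [a]: the line [m] crosses two sides of the triangle
   formed by [m1], [k] and [l], hence also the third. *)
have [|c [d [m2 [[kc nWc ca] [[ld nWd] [Lm2 m2p m2c m2d]]]]]] :=
    @proper_perspectivity k l p a pk pl nkp nlp.
  move=> c kc nWc ca.
  have pc : p <> c by move=> e; apply: nkp; rewrite e.
  have [m [Lm mp mc]] := join_line pc.
  have [d [md ld]] := veblenL Lm1 Lk Lm Ll m1k m1a m1p m1b ka kc kw
    (nesym pa) ab (nesym ca) aw mp mc lb lw.
  by exists d, m.
split=> //; exists p, m1, m2; split; split=> //.
- exact: proper_line_point Lm2 m2p nWp.
- move=> e; apply: m1k; apply: (line_eq Lm1 Lk ca) => //.
  by rewrite e.
- by split=> //; [exists a | exists b | exists c | exists d].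
Qed.

Definition share_improper k l := k = l \/ parallel k l.

Lemma share_improperI k l w : proper_lines L W k -> proper_lines L W l ->
  W w -> k w -> l w -> share_improper k l.
Proof.
move=> pk pl Ww kw lw; have [|kl] := pselect (k = l); first by left.
by right; apply/(parallelP pk pl); split=> //; exists w.
Qed.

Lemma share_improperE k l : proper_lines L W k -> proper_lines L W l ->
  share_improper k l -> k <> l -> exists w, [/\ W w, k w & l w].
Proof. by move=> pk pl [//|/(parallelP pk pl)[]]. Qed.

(** * Recognising the pencil of an improper point *)

(** A point outside the span of [a], [b], [c] exists by the dimension
    hypothesis.  If the span contains a proper point, the join of the two is a
    proper line meeting the span only once, so a second proper point of this
    line will do. *)
Lemma exists_proper_outside a b c :
  exists P, [/\ subspace L P, P a, P b, P c & exists2 q, ~ W q & ~ P q].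
Proof.
pose A := [set a] `|` [set b] `|` [set c].
have A_span : A `<=` span L A by exact: sub_gen_smallest.
have spanS : subspace L (span L A).
  move=> k x y Lk kx ky spx spy xy z kz P [subP AP].
  by apply: (subP k x y) => //; [apply: spx | apply: spy].
have [q0 nq0] : exists q, ~ span L A q.
  apply: contrapT => nex.
  have : span L A = setT.
    by apply/seteqP; split=> // q _; apply: contrapT => ?; apply: nex; exists q.
  move=> /dim3 A_big.
  have := card_le_trans A_big (card_le_setU (card_le_setU (card_set1_le a)
    (card_set1_le b)) (card_set1_le c)).
  by rewrite card_le_II.
exists (span L A); split=> //.
- by apply: A_span; left; left.
- by apply: A_span; left; right.
- by apply: A_span; right.
have [e nWe] := exists_proper_point.
have [spe|] := pselect (span L A e); last by exists e.
have eq0 : e <> q0 by move=> e0; apply: nq0; rewrite -e0.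
have [k [Lk ke kq0]] := join_line eq0.
have [q [kq nWq qe _]] := another_proper_point e e (proper_line_point Lk ke nWe).
by exists q => // spq; apply: nq0; exact: (spanS k q e).
Qed.

Definition transversal n k l m :=
  [/\ proper_lines L W n, meets_properly n k, meets_properly n l
    & meets_properly n m].

(** Meeting [k] and [l] improperly does not force [m] through their common
    point when [m] is in their plane; the line [m'] outside this plane serves
    to exclude that case. *)
Definition in_pencil k l m :=
  [/\ share_improper m k, share_improper m l &
    exists m', [/\ proper_lines L W m', share_improper m' k,
      share_improper m' l & share_improper m' m] /\
      ~ exists n, transversal n k l m'].

Lemma exists_transversal k l : proper_lines L W k -> proper_lines L W l ->
  ~ meets_properly k l ->
  exists n, [/\ proper_lines L W n, meets_properly n k & meets_properly n l].
Proof.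
move=> pk pl nkl; have [a ka nWa] := proper_line_has_point pk.
have [b lb nWb] := proper_line_has_point pl.
have ab : a <> b by move=> e; apply: nkl; exists a; rewrite {3}e.
have [n [Ln na nb]] := join_line ab.
exists n; split.
- exact: proper_line_point Ln na nWa.
- by exists a.
- by exists b.
Qed.

(** If [m] met [k] and [l] in two different points, it would be in their plane,
    and the perspectivity from a proper point of [m] would produce a line
    crossing all three properly. *)
Lemma transversal_free_in_pencil k l m w :
  proper_lines L W k -> proper_lines L W l -> proper_lines L W m ->
  k <> l -> W w -> k w -> l w -> share_improper m k -> share_improper m l ->
  (~ exists n, transversal n k l m) -> [/\ m w, m <> k & m <> l].
Proof.
move=> pk pl pm kl Ww kw lw mk ml none.
have [[[Lk _] [Ll _]] [Lm _]] := (pk, pl, pm).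
have kl_w x : k x -> l x -> x = w.
  by move=> kx lx; apply: contrapT => xw; apply: kl; apply: (line_eq _ _ xw).
have [n [pn nk nl]] : exists n,
    [/\ proper_lines L W n, meets_properly n k & meets_properly n l].
  by apply: exists_transversal => // -[a [nWa ka la]]; apply: nWa;
    rewrite (kl_w a).
have mNk : m <> k by move=> e; apply: none; exists n; split=> //; rewrite e.
have mNl : m <> l by move=> e; apply: none; exists n; split=> //; rewrite e.
have [x [Wx mx kx]] := share_improperE pm pk mk mNk.
have [y [Wy my ly]] := share_improperE pm pl ml mNl.
split=> //; apply: contrapT => nmw.
have [p mp nWp] := proper_line_has_point pm.
have xp : x <> p by move=> e; apply: nWp; rewrite -e.
have yp : y <> p by move=> e; apply: nWp; rewrite -e.
have xw : x <> w by move=> e; apply: nmw; rewrite -e.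
have xy : x <> y by move=> e; apply: xw; apply: kl_w; rewrite // e.
have nkp : ~ k p by move=> kp; apply: mNk; apply: (line_eq _ _ xp).
have nlp : ~ l p by move=> lp; apply: mNl; apply: (line_eq _ _ yp).
have [|c [d [t [[kc nWc _] [[ld nWd] [Lt tp tc td]]]]]] :=
    @proper_perspectivity k l p w pk pl nkp nlp.
  move=> c kc nWc _.
  have pc : p <> c by move=> e; apply: nkp; rewrite e.
  have xc : x <> c by move=> e; apply: nWc; rewrite -e.
  have [t [Lt tp tc]] := join_line pc.
  have [d [td ld]] := veblenL Lm Lk Lt Ll mNk mx mp my kx kc kw
    xp xy xc xw tp tc ly lw.
  by exists d, t.
apply: none; exists t; split; first exact: proper_line_point Lt tp nWp.
- by exists c.
- by exists d.
- by exists p.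
Qed.

(** For a line [m] through [w], the auxiliary line joins [w] to a proper point
    outside the plane of [k] and [l].  Conversely, if [m] missed [w], it would
    meet [k], [l] and [m'] in three different points, so that [m'] would be in
    the plane of [k] and [l]; a perspectivity from a proper point of [m'] then
    gives a transversal that is not supposed to exist. *)
Lemma in_pencilP k l m w :
  proper_lines L W k -> proper_lines L W l -> proper_lines L W m ->
  k <> l -> W w -> k w -> l w -> in_pencil k l m <-> m w.
Proof.
move=> pk pl pm kl Ww kw lw.
have [[[Lk _] [Ll _]] [Lm _]] := (pk, pl, pm).
have kl_w x : k x -> l x -> x = w.
  by move=> kx lx; apply: contrapT => xw; apply: kl; apply: (line_eq _ _ xw).
split; last first.
  move=> mw.
  have [a ka nWa] := proper_line_has_point pk.
  have [b lb nWb] := proper_line_has_point pl.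
  have aw : a <> w by move=> e; apply: nWa; rewrite e.
  have bw : b <> w by move=> e; apply: nWb; rewrite e.
  have [P [subP Pw Pa Pb [q nWq nPq]]] := exists_proper_outside w a b.
  have kP : k `<=` P by apply: (subP k a w).
  have lP : l `<=` P by apply: (subP l b w).
  have wq : w <> q by move=> e; apply: nPq; rewrite -e.
  have [m' [Lm' m'w m'q]] := join_line wq.
  have pm' := proper_line_point Lm' m'q nWq.
  split; [exact: share_improperI pm pk Ww mw kw |
    exact: share_improperI pm pl Ww mw lw | exists m'; split].
    by split=> //; apply: (share_improperI _ _ Ww).
  move=> [n [[Ln _] [c [nWc nc kc]] [d [nWd nd ld]] [e [nWe ne m'e]]]].
  apply: nPq; have cd : c <> d.
    by move=> E; apply: nWc; rewrite (kl_w c) // E.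
  have Pe : P e by apply: (subP n c d) => //; [apply: kP | apply: lP].
  by apply: (subP m' w e) => // E; apply: nWe; rewrite -E.
move=> [mk ml [m' [[pm' m'k m'l m'm] none]]].
have [m'w m'Nk m'Nl] :=
  transversal_free_in_pencil pk pl pm' kl Ww kw lw m'k m'l none.
have [Lm' _] := pm'.
apply: contrapT => nmw.
have mNk : m <> k by move=> e; apply: nmw; rewrite e.
have mNl : m <> l by move=> e; apply: nmw; rewrite e.
have m'Nm : m' <> m by move=> e; apply: nmw; rewrite -e.
have [x [Wx mx kx]] := share_improperE pm pk mk mNk.
have [y [Wy my ly]] := share_improperE pm pl ml mNl.
have [z [Wz m'z mz]] := share_improperE pm' pm m'm m'Nm.
have wN u : m u -> w <> u by move=> mu e; apply: nmw; rewrite e.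
have xy : x <> y by move=> e; apply: (wN x mx); rewrite (kl_w x) // e.
have [p m'p nWp] := proper_line_has_point pm'.
have wp : w <> p by move=> e; apply: nWp; rewrite -e.
have nkp : ~ k p by move=> kp; apply: m'Nk; apply: (line_eq _ _ wp).
have nlp : ~ l p by move=> lp; apply: m'Nl; apply: (line_eq _ _ wp).
have [|c [d [t [[kc nWc _] [[ld nWd] [Lt tp tc td]]]]]] :=
    @proper_perspectivity k l p w pk pl nkp nlp.
  move=> c kc nWc _.
  have pc : p <> c by move=> e; apply: nkp; rewrite e.
  have wc : w <> c by move=> e; apply: nWc; rewrite -e.
  have xc : x <> c by move=> e; apply: nWc; rewrite -e.
  have [t [Lt tp tc]] := join_line pc.
  (* Apply Veblen's axiom at [w] to get from [k] and [m'] to [m], then at [x]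
     to get from [k] and [m] to [l]. *)
  have [q [tq mq]] := veblenL Lk Lm' Lt Lm (nesym m'Nk) kw kc kx m'w m'p m'z
    wc (wN x mx) wp (wN z mz) tc tp mx mz.
  have xq : x <> q.
    move=> e; apply: nkp; rewrite (@line_eq k t x c) //.
    by rewrite e.
  have [d [td ld]] := veblenL Lk Lm Lt Ll (nesym mNk) kx kc kw mx mq my
    xc (nesym (wN x mx)) xq xy tc tq lw ly.
  by exists d, t.
apply: none; exists t; split; first exact: proper_line_point Lt tp nWp.
- by exists c.
- by exists d.
- by exists p.
Qed.

(** * Recognising the points of an improper line *)

(** The sets [Q1], [Q2], [Q3] stand for pencils of proper lines.  One point [p]
    would not suffice: it tests only whether the line [m3] joining it to the
    third point lies in the plane of [p] and the other two points, and [m3] may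
    have several improper points. *)
Definition seen_collinear (Q1 Q2 Q3 : set (set S)) := forall p, ~ W p ->
  exists m1 m2 m3 n,
    [/\ proper_lines L W m1, proper_lines L W m2, proper_lines L W m3
      & proper_lines L W n] /\
    [/\ Q1 m1, Q2 m2 & Q3 m3] /\ [/\ m1 p, m2 p, m3 p & ~ n p] /\
    [/\ meets_properly n m1, meets_properly n m2 & meets_properly n m3].

Definition is_pencil (Q : set (set S)) w :=
  forall m, proper_lines L W m -> Q m <-> m w.

(** If all proper points see [w1], [w2], [w3] as collinear, take one outside a
    subspace containing the three points: [m3] meets [j] in the plane of [p],
    [w1], [w2], and it meets the subspace only in [w3], so that [w3] is on [j].
    Conversely, let [w3] be on [j], and project [m2] to [m3] from a proper
    point [a] of [m1]; Veblen's axiom, applied first at [p] and then at [w1],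
    shows that this is defined. *)
Lemma seen_collinearP j w1 w2 w3 Q1 Q2 Q3 :
  L j -> j `<=` W -> j w1 -> j w2 -> w1 <> w2 -> W w3 ->
  is_pencil Q1 w1 -> is_pencil Q2 w2 -> is_pencil Q3 w3 ->
  seen_collinear Q1 Q2 Q3 <-> j w3.
Proof.
move=> Lj jW jw1 jw2 w12 Ww3 Q1P Q2P Q3P.
have [Ww1 Ww2] := (jW _ jw1, jW _ jw2).
have jN k a : ~ W a -> k a -> j <> k.
  by move=> nWa ka e; apply: nWa; apply: jW; rewrite e.
have WN x a : W x -> ~ W a -> x <> a by move=> Wx nWa e; apply: nWa; rewrite -e.
split.
  have [P [subP Pw1 Pw2 Pw3 [p nWp nPp]]] := exists_proper_outside w1 w2 w3.
  have jP : j `<=` P by apply: (subP j w1 w2).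
  move=> /(_ p nWp) [m1 [m2 [m3 [n [[pm1 pm2 pm3 [Ln _]]]]]]].
  move=> [[/(Q1P _ pm1) m1w1 /(Q2P _ pm2) m2w2 /(Q3P _ pm3) m3w3]].
  have [[[Lm1 _] [Lm2 _]] [Lm3 _]] := (pm1, pm2, pm3).
  move=> [[m1p m2p m3p nnp]].
  move=> [[a [nWa na m1a]] [b [nWb nb m2b]] [c [nWc nc m3c]]].
  have pN x : n x -> p <> x by move=> nx e; apply: nnp; rewrite e.
  have m12 : m1 <> m2.
    move=> e; apply: (@jN m1 p) => //; apply: (line_eq _ _ w12) => //.
    by rewrite e.
  have [u [ju nu]] := veblenL Lm1 Lm2 Lj Ln m12 m1p m1w1 m1a m2p m2w2 m2b
    (nesym (WN _ _ Ww1 nWp)) (pN a na) (nesym (WN _ _ Ww2 nWp)) (pN b nb)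
    jw1 jw2 na nb.
  have m1n : m1 <> n by move=> e; apply: nnp; rewrite -e.
  (* If [a = c], then [m1] and [m3] coincide, and Veblen's axiom cannot be
     applied at [a]; but then [w1 = w3], as [m1] leaves the subspace. *)
  have [ac|ac] := pselect (a = c).
    have m13 : m1 = m3.
      by apply: (line_eq _ _ (pN a na)) => //; rewrite ac.
    apply: contrapT => njw3; apply: nPp; apply: (subP m1 w1 w3) => //.
    - by rewrite m13.
    - by move=> e; apply: njw3; rewrite -e.
  have [v [jv m3v]] := veblenL Lm1 Ln Lj Lm3 m1n m1a m1w1 m1p na nu nc
    (nesym (WN _ _ Ww1 nWa)) (nesym (pN a na))
    (nesym (WN _ _ (jW u ju) nWa)) ac jw1 ju m3p m3c.
  have [->//|vw3] := pselect (w3 = v).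
  by case: nPp; apply: (subP m3 w3 v) => //; apply: jP.
move=> jw3 p nWp.
have [m1 [Lm1 m1p m1w1]] := join_line (nesym (WN _ _ Ww1 nWp)).
have [m2 [Lm2 m2p m2w2]] := join_line (nesym (WN _ _ Ww2 nWp)).
have [m3 [Lm3 m3p m3w3]] := join_line (nesym (WN _ _ Ww3 nWp)).
have pm1 := proper_line_point Lm1 m1p nWp.
have pm2 := proper_line_point Lm2 m2p nWp.
have pm3 := proper_line_point Lm3 m3p nWp.
have distinct k k' x x' : k p -> L k -> k x -> k' x' -> j x -> j x' ->
    x <> x' -> k <> k'.
  move=> kp Lk kx k'x' jx jx' xx' e; apply: (@jN k p) => //.
  by apply: (line_eq _ _ xx') => //; rewrite e.
have m12 := distinct _ _ _ _ m1p Lm1 m1w1 m2w2 jw1 jw2 w12.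
have [a [m1a nWa ap _]] := another_proper_point p p pm1.
have nm2a : ~ m2 a by move=> m2a; apply: m12; apply: (line_eq _ _ ap).
suff [n [Ln nna [np n2 n3]]] : exists n, [/\ L n, n a &
    [/\ ~ n p, meets_properly n m2 & meets_properly n m3]].
  exists m1, m2, m3, n; split.
    by split=> //; exact: proper_line_point Ln nna nWa.
  split; first by split; [apply/Q1P | apply/Q2P | apply/Q3P].
  by split=> //; split=> //; exists a.
have off_p n b : L n -> n a -> m2 b -> n b -> b <> p -> ~ n p.
  move=> Ln na m2b nb bp np; apply: nm2a.
  by rewrite (@line_eq m2 n b p).
(* For [w3] equal to [w1] or [w2] there are only two lines through [p] to be
   crossed, and any line through [a] and a proper point of [m2] will do. *)
have [w31|w31] := pselect (w3 = w1); last have [w32|w32] := pselect (w3 = w2).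
- have m31 : m3 = m1.
    by apply: (line_eq _ _ (WN _ _ Ww3 nWp)) => //; rewrite w31.
  have [b [m2b nWb bp _]] := another_proper_point p p pm2.
  have ab : a <> b by move=> e; apply: nm2a; rewrite e.
  have [n [Ln na nb]] := join_line ab.
  exists n; split=> //; split; first exact: off_p nb bp.
    by exists b.
  by exists a; rewrite m31.
- have m32 : m3 = m2.
    by apply: (line_eq _ _ (WN _ _ Ww3 nWp)) => //; rewrite w32.
  have [b [m2b nWb bp _]] := another_proper_point p p pm2.
  have ab : a <> b by move=> e; apply: nm2a; rewrite e.
  have [n [Ln na nb]] := join_line ab.
  exists n; split=> //; split; first exact: off_p nb bp.
    by exists b.
  by exists b; rewrite m32.
have m13 := distinct _ _ _ _ m1p Lm1 m1w1 m3w3 jw1 jw3 (nesym w31).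
have nm3a : ~ m3 a by move=> m3a; apply: m13; apply: (line_eq _ _ ap).
have [|c [d [n [[m2c nWc cp] [[m3d nWd] [Ln na nc nd]]]]]] :=
    @proper_perspectivity m2 m3 a p pm2 pm3 nm2a nm3a.
  move=> c m2c nWc cp.
  have ac : a <> c by move=> e; apply: nm2a; rewrite e.
  have [n [Ln na nc]] := join_line ac.
  have [u [nu ju]] := veblenL Lm1 Lm2 Ln Lj m12 m1p m1a m1w1 m2p m2c m2w2
    (nesym ap) (nesym (WN _ _ Ww1 nWp)) (nesym cp) (nesym (WN _ _ Ww2 nWp))
    na nc jw1 jw2.
  have w1u : w1 <> u.
    move=> e; apply: m12; apply: (line_eq Lm1 Lm2 cp) => //.
    rewrite (@line_eq m1 n a w1) //; first exact: nesym (WN _ _ Ww1 nWa).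
    by rewrite e.
  have jm1 : m1 <> j by apply: nesym; exact: (@jN m1 p).
  have [d [nd m3d]] := veblenL Lm1 Lj Ln Lm3 jm1 m1w1 m1a m1p jw1 ju jw3
    (WN _ _ Ww1 nWa) (WN _ _ Ww1 nWp) w1u (nesym w31) na nu m3p m3w3.
  by exists d, n.
exists n; split=> //; split; first exact: off_p nc cp.
- by exists c.
- by exists d.
Qed.

(** * Defining formulas *)

Local Infix "/\f" := FAnd (at level 80, right associativity).
Local Notation "x '=f' y" := (FEq x y) (at level 70).
Local Notation "p 'onf' k" := (FInc p k) (at level 70).
Local Notation x0 := (VarO _ _).
Local Notation "^ x" := (VarS _ x) (at level 2, right associativity, format "^ x").
Local Notation x1 := ^x0.
Local Notation x2 := ^x1.
Local Notation x3 := ^x2.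
Local Notation x4 := ^x3.
Local Notation x5 := ^x4.
Local Notation x6 := ^x5.
Local Notation x7 := ^x6.

Definition meetsF G (k l : var G Ln) : form G :=
  @FEx G Pt (x0 onf ^k /\f x0 onf ^l).

Definition parallelF G (k l : var G Ln) : form G :=
  FNot (k =f l) /\f FNot (meetsF k l) /\f
  @FEx G Pt (@FEx _ Ln (@FEx _ Ln
    (FNot (x1 =f x0) /\f x2 onf x1 /\f x2 onf x0 /\f
     FNot (x2 onf ^^^k) /\f FNot (x2 onf ^^^l) /\f
     meetsF x1 ^^^k /\f meetsF x1 ^^^l /\f meetsF x0 ^^^k /\f
     meetsF x0 ^^^l))).

Definition share_improperF G (k l : var G Ln) : form G :=
  FOr (k =f l) (parallelF k l).

Definition in_pencilF G (k l m : var G Ln) : form G :=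
  share_improperF m k /\f share_improperF m l /\f
  @FEx G Ln
    (share_improperF x0 ^k /\f share_improperF x0 ^l /\f
     share_improperF x0 ^m /\f
     FNot (@FEx _ Ln (meetsF x0 ^^k /\f meetsF x0 ^^l /\f meetsF x0 x1))).

Definition seen_collinearF G (k1 l1 k2 l2 k3 l3 : var G Ln) : form G :=
  @FAll G Pt (@FEx _ Ln (@FEx _ Ln (@FEx _ Ln (@FEx _ Ln
    (in_pencilF ^^^^^k1 ^^^^^l1 x3 /\f
     in_pencilF ^^^^^k2 ^^^^^l2 x2 /\f
     in_pencilF ^^^^^k3 ^^^^^l3 x1 /\f
     x4 onf x3 /\f x4 onf x2 /\f x4 onf x1 /\f FNot (x4 onf x0) /\f
     meetsF x0 x3 /\f meetsF x0 x2 /\f meetsF x0 x1))))).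

(** Two equal improper points lie on a common proper line, so the last clause
    also says that the two encoded points are distinct. *)
Definition improper_lineF G (k1 l1 k2 l2 : var G Ln) : form G :=
  parallelF k1 l1 /\f parallelF k2 l2 /\f
  FNot (@FEx _ Ln (in_pencilF ^k1 ^l1 x0 /\f in_pencilF ^k2 ^l2 x0)).

Definition pt_domF (G : tshape) : form G :=
  match G with
  | [:: Pt] => FNot (FFalse _)
  | [:: Ln; Ln] => parallelF x0 x1
  | _ => FFalse _
  end.

Definition ln_domF (G : tshape) : form G :=
  match G with
  | [:: Ln] => FNot (FFalse _)
  | [:: Ln; Ln; Ln; Ln] => improper_lineF x0 x1 x2 x3
  | _ => FFalse _
  end.

Definition pt_eqvF (G H : tshape) : form (G ++ H) :=
  match G, H with
  | [:: Pt], [:: Pt] => x0 =f x1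
  | [:: Ln; Ln], [:: Ln; Ln] => in_pencilF x0 x1 x2 /\f in_pencilF x0 x1 x3
  | _, _ => FFalse _
  end.

Definition ln_eqvF (G H : tshape) : form (G ++ H) :=
  match G, H with
  | [:: Ln], [:: Ln] => x0 =f x1
  | [:: Ln; Ln; Ln; Ln], [:: Ln; Ln; Ln; Ln] =>
      seen_collinearF x0 x1 x2 x3 x4 x5 /\f seen_collinearF x0 x1 x2 x3 x6 x7
  | _, _ => FFalse _
  end.

Definition inc_relF (G H : tshape) : form (G ++ H) :=
  match G, H with
  | [:: Pt], [:: Ln] => x0 onf x1
  | [:: Ln; Ln], [:: Ln] => in_pencilF x0 x1 x2
  | [:: Ln; Ln], [:: Ln; Ln; Ln; Ln] => seen_collinearF x2 x3 x4 x5 x0 x1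
  | _, _ => FFalse _
  end.

Definition set_relF (G : tshape) : form G :=
  match G with
  | [:: Ln; Ln] => FNot (FFalse _)
  | _ => FFalse _
  end.

Definition recovery : interpretation := {|
  pt_shapes := [:: [:: Pt]; [:: Ln; Ln]];
  ln_shapes := [:: [:: Ln]; [:: Ln; Ln; Ln; Ln]];
  pt_dom := pt_domF;
  ln_dom := ln_domF;
  pt_eqv := pt_eqvF;
  ln_eqv := ln_eqvF;
  inc_rel := inc_relF;
  set_rel := set_relF |}.

(** * Meaning of the formulas in the complement *)

Local Notation M := (complement L W).

Lemma proper_point_val (p : ipoint M) : ~ W (val p).
Proof. exact: set_mem (valP p). Qed.

Lemma proper_val (k : iline M) : proper_lines L W (val k).
Proof. exact: set_mem (valP k). Qed.

Lemma proper_point_ex a : ~ W a -> exists p : ipoint M, val p = a.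
Proof. by move=> nWa; exists (exist _ a (mem_set nWa)). Qed.

Lemma proper_line_ex k : proper_lines L W k -> exists x : iline M, val x = k.
Proof. by move=> pk; exists (exist _ k (mem_set pk)). Qed.

Lemma sat_meets G (k l : var G Ln) (e : tup M G) :
  sat (meetsF k l) e <->
  meets_properly (val (lookup k e)) (val (lookup l e)).
Proof.
split=> /=; first by move=> [p [pk pl]]; exists (val p); split=> //;
  exact: proper_point_val.
move=> [a [/proper_point_ex[p <-] pk pl]].
by exists p.
Qed.

Lemma sat_parallel G (k l : var G Ln) (e : tup M G) :
  sat (parallelF k l) e <-> parallel (val (lookup k e)) (val (lookup l e)).
Proof.
split.
  move=> [kl [nm [p [m1 [m2 [m12 [pm1 [pm2 [pk [pl [c1 [c2 [c3 c4]]]]]]]]]]]]].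
  split; first by move=> /val_inj; exact: kl.
    by move=> /(sat_meets k l e).
  exists (val p), (val m1), (val m2); split; [|split].
  - by split; [exact: proper_point_val | exact: proper_val
      | exact: proper_val | move=> /val_inj; exact: m12].
  - by [].
  - by split; [move/sat_meets: c1 | move/sat_meets: c2 | move/sat_meets: c3
      | move/sat_meets: c4].
move=> [kl nm [p' [m1' [m2' [[]]]]]].
move=> /proper_point_ex[p <-].
move=> /proper_line_ex[m1 <-].
move=> /proper_line_ex[m2 <-].
move=> m12 [[pm1 pm2 pk pl] [c1 c2 c3 c4]].
split; first by move=> /= e_kl; apply: kl; rewrite e_kl.
split; first by move=> /sat_meets.
exists p, m1, m2; split; first by move=> /= e_m; apply: m12; rewrite e_m.
do 4 ![split=> //].
by split; [|split; [|split]]; apply/sat_meets.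
Qed.

Lemma sat_share_improper G (k l : var G Ln) (e : tup M G) :
  sat (share_improperF k l) e <->
  share_improper (val (lookup k e)) (val (lookup l e)).
Proof.
split; move=> [kl|kl].
- by left; rewrite [lookup k e]kl.
- by right; apply/sat_parallel.
- by left; apply: val_inj.
- by right; apply/sat_parallel.
Qed.

Definition encodes (k l : iline M) (w : S) : Prop :=
  [/\ val k <> val l, W w, val k w & val l w].

Lemma sat_parallel_encodes G (k l : var G Ln) (e : tup M G) :
  sat (parallelF k l) e <-> exists w, encodes (lookup k e) (lookup l e) w.
Proof.
apply: iff_trans (sat_parallel k l e) _.
apply: iff_trans (parallelP (proper_val _) (proper_val _)) _.
split; first by move=> [kl [w [Ww kw lw]]]; exists w.
by move=> [w [kl Ww kw lw]]; split=> //; exists w.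
Qed.

Lemma sat_in_pencil G (k l m : var G Ln) (e : tup M G) :
  sat (in_pencilF k l m) e <->
  in_pencil (val (lookup k e)) (val (lookup l e)) (val (lookup m e)).
Proof.
split.
  move=> [mk [ml [m' [m'k [m'l [m'm none]]]]]].
  split; [exact/sat_share_improper | exact/sat_share_improper |].
  exists (val m'); split.
    split; first exact: proper_val.
    - by move/sat_share_improper: m'k.
    - by move/sat_share_improper: m'l.
    - by move/sat_share_improper: m'm.
  move=> [n' [/proper_line_ex[n <-] nk nl nm']]; apply: none; exists n.
  by split; [|split]; apply/sat_meets.
move=> [mk ml [m'' [[/proper_line_ex[m' <-] m'k m'l m'm] none]]].
split; first exact/sat_share_improper.
split; first exact/sat_share_improper.
exists m'; split; first exact/sat_share_improper.
split; first exact/sat_share_improper.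
split; first exact/sat_share_improper.
move=> [n [nk [nl nm']]]; apply: none; exists (val n); split.
- exact: proper_val.
- by move/sat_meets: nk.
- by move/sat_meets: nl.
- by move/sat_meets: nm'.
Qed.

Lemma encodes_pencil (k l : iline M) w : encodes k l w ->
  is_pencil (in_pencil (val k) (val l)) w.
Proof.
move=> [kl Ww kw lw] m pm.
exact: in_pencilP (proper_val k) (proper_val l) pm kl Ww kw lw.
Qed.

Lemma sat_seen_collinear G (k1 l1 k2 l2 k3 l3 : var G Ln) (e : tup M G) :
  sat (seen_collinearF k1 l1 k2 l2 k3 l3) e <->
  seen_collinear (in_pencil (val (lookup k1 e)) (val (lookup l1 e)))
    (in_pencil (val (lookup k2 e)) (val (lookup l2 e)))
    (in_pencil (val (lookup k3 e)) (val (lookup l3 e))).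
Proof.
split.
  move=> H p' /proper_point_ex[p <-].
  have [m1 [m2 [m3 [n]]]] := H p.
  move=> [i1 [i2 [i3 [pm1 [pm2 [pm3 [pn [n1 [n2 n3]]]]]]]]].
  exists (val m1), (val m2), (val m3), (val n).
  split; first by split; exact: proper_val.
  split; first by split; [move/sat_in_pencil: i1
    | move/sat_in_pencil: i2 | move/sat_in_pencil: i3].
  split=> //.
  by split; [move/sat_meets: n1 | move/sat_meets: n2 | move/sat_meets: n3].
move=> H p; have [m1' [m2' [m3' [n' [[]]]]]] := H _ (@proper_point_val p).
move=> /proper_line_ex[m1 <-] /proper_line_ex[m2 <-].
move=> /proper_line_ex[m3 <-] /proper_line_ex[n <-].
move=> [[i1 i2 i3] [[pm1 pm2 pm3 pn] [n1 n2 n3]]].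
exists m1, m2, m3, n.
split; first exact/sat_in_pencil.
split; first exact/sat_in_pencil.
split; first exact/sat_in_pencil.
do 4![split=> //].
by split; [|split]; apply/sat_meets.
Qed.

Lemma encodes_seen_collinear j (k1 l1 k2 l2 k3 l3 : iline M) w1 w2 w3 :
  L j -> j `<=` W -> j w1 -> j w2 -> w1 <> w2 ->
  encodes k1 l1 w1 -> encodes k2 l2 w2 -> encodes k3 l3 w3 ->
  seen_collinear (in_pencil (val k1) (val l1)) (in_pencil (val k2) (val l2))
    (in_pencil (val k3) (val l3)) <-> j w3.
Proof.
move=> Lj jW jw1 jw2 w12 e1 e2 e3; have [_ Ww3 _ _] := e3.
exact: seen_collinearP Lj jW jw1 jw2 w12 Ww3
  (encodes_pencil e1) (encodes_pencil e2) (encodes_pencil e3).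
Qed.

Lemma encodes_exists w : W w -> exists k l : iline M, encodes k l w.
Proof.
move=> Ww; have [a nWa] := exists_proper_point.
have wa : w <> a by move=> e; apply: nWa; rewrite -e.
have [P [subP Pw Pa _ [q nWq nPq]]] := exists_proper_outside w a a.
have wq : w <> q by move=> e; apply: nPq; rewrite -e.
have [k' [Lk' kw ka]] := join_line wa.
have [l' [Ll' lw lq]] := join_line wq.
have [k kE] := proper_line_ex (proper_line_point Lk' ka nWa).
have [l lE] := proper_line_ex (proper_line_point Ll' lq nWq).
exists k, l; rewrite /encodes kE lE; split=> // kl.
by apply: nPq; apply: (subP k' w a) => //; rewrite kl.
Qed.

Lemma encodes_eq (k l k' l' : iline M) w w' : encodes k l w -> encodes k' l' w' ->
  val k' w -> val l' w -> w = w'.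
Proof.
move=> _ [kl' _ k'w' l'w'] k'w l'w; apply: contrapT => ww'; apply: kl'.
by apply: (line_eq (proper_val k').1 (proper_val l').1 ww').
Qed.

Lemma sat_improper_line G (k1 l1 k2 l2 : var G Ln) (e : tup M G) :
  sat (improper_lineF k1 l1 k2 l2) e <->
  exists j w1 w2, [/\ encodes (lookup k1 e) (lookup l1 e) w1,
    encodes (lookup k2 e) (lookup l2 e) w2 & w1 <> w2] /\
    [/\ L j, j `<=` W, j w1 & j w2].
Proof.
split.
  move=> [/sat_parallel_encodes[w1 e1] [/sat_parallel_encodes[w2 e2] none]].
  have no_line (m : iline M) : val m w1 -> val m w2 -> False.
    move=> mw1 mw2; apply: none; exists m.
    split; apply/sat_in_pencil.
      by apply/(encodes_pencil e1) => //; exact: proper_val.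
    by apply/(encodes_pencil e2) => //; exact: proper_val.
  have w12 : w1 <> w2.
    move=> ww; case: (e1) => _ _ kw1 _.
    by apply: (no_line (lookup k1 e)) => //; rewrite -ww.
  have [j [Lj jw1 jw2]] := join_line w12.
  exists j, w1, w2; split=> //; split=> //.
  apply: contrapT => nW; have pj : proper_lines L W j by [].
  by have [m mE] := proper_line_ex pj; apply: (no_line m); rewrite mE.
move=> [j [w1 [w2 [[e1 e2 w12] [Lj jW jw1 jw2]]]]].
split; first by apply/sat_parallel_encodes; exists w1.
split; first by apply/sat_parallel_encodes; exists w2.
move=> [m [/sat_in_pencil/(encodes_pencil e1 (proper_val m)) mw1]].
move=> /sat_in_pencil/(encodes_pencil e2 (proper_val m)) mw2.
have [Lm nmW] := proper_val m.
by apply: nmW; rewrite -(line_eq Lj Lm w12).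
Qed.

(** * The isomorphism *)

(** The maps on codes are first described as relations.  That they are
    single-valued follows from [pt_eqvP] and [ln_eqvP] below, applied to two
    values of one code. *)
Inductive denotes_pt : code M -> S -> Prop :=
| DenotesProperPoint (p : ipoint M) : denotes_pt (pt_code p) (val p)
| DenotesImproperPoint (k l : iline M) w : encodes k l w ->
    denotes_pt (existT (tup M) [:: Ln; Ln] (k, (l, tt))) w.

Inductive denotes_ln : code M -> set S -> Prop :=
| DenotesProperLine (k : iline M) : denotes_ln (ln_code k) (val k)
| DenotesImproperLine (k1 l1 k2 l2 : iline M) w1 w2 j :
    encodes k1 l1 w1 -> encodes k2 l2 w2 -> w1 <> w2 ->
    L j -> j `<=` W -> j w1 -> j w2 ->
    denotes_ln (existT (tup M) [:: Ln; Ln; Ln; Ln] (k1, (l1, (k2, (l2, tt))))) j.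

Lemma pt_codesP (c : code M) : pt_codes recovery M c <-> exists s, denotes_pt c s.
Proof.
split; last first.
  move=> [s [p|k l w klw]]; split=> //.
  by apply: (@sat_parallel_encodes [:: Ln; Ln] x0 x1 (k, (l, tt))).2; exists w.
case: c => G t [/=]; rewrite !inE => /orP[]/eqP GE; subst G.
  by move: t => [p []] _; exists (val p); exact: DenotesProperPoint.
move: t => [k [l []]] /sat_parallel_encodes[w klw].
by exists w; exact: DenotesImproperPoint.
Qed.

Lemma ln_codesP (c : code M) : ln_codes recovery M c <-> exists j, denotes_ln c j.
Proof.
split; last first.
  move=> [s [k|k1 l1 k2 l2 w1 w2 j e1 e2 w12 Lj jW jw1 jw2]]; split=> //.
  apply: (@sat_improper_line [:: Ln; Ln; Ln; Ln] x0 x1 x2 x3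
    (k1, (l1, (k2, (l2, tt))))).2.
  by exists j, w1, w2.
case: c => G t [/=]; rewrite !inE => /orP[]/eqP GE; subst G.
  by move: t => [k []] _; exists (val k); exact: DenotesProperLine.
move: t => [k1 [l1 [k2 [l2 []]]]] /sat_improper_line.
move=> [j [w1 [w2 [[e1 e2 w12] [Lj jW jw1 jw2]]]]].
by exists j; exact: DenotesImproperLine e1 e2 w12 Lj jW jw1 jw2.
Qed.

Lemma pt_eqvP (c d : code M) s t : denotes_pt c s -> denotes_pt d t ->
  holds2 (pt_eqv recovery) c d <-> s = t.
Proof.
case=> [p|k l w klw]; case=> [p'|k' l' w' klw'].
- by split=> [pp'|/val_inj //]; congr val; exact: pp'.
- by split=> // e; have [_ Ww' _ _] := klw'; case: (@proper_point_val p); rewrite e.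
- by split=> // e; have [_ Ww _ _] := klw; case: (@proper_point_val p'); rewrite -e.
split.
  move=> [/sat_in_pencil/(encodes_pencil klw (proper_val k')) k'w].
  move=> /sat_in_pencil/(encodes_pencil klw (proper_val l')) l'w.
  exact: encodes_eq klw klw' k'w l'w.
move=> ww'; have [_ _ k'w l'w] := klw'; rewrite -ww' in k'w l'w.
split; apply/sat_in_pencil.
  by apply/(encodes_pencil klw) => //; exact: proper_val.
by apply/(encodes_pencil klw) => //; exact: proper_val.
Qed.

Lemma ln_eqvP (c d : code M) i j : denotes_ln c i -> denotes_ln d j ->
  holds2 (ln_eqv recovery) c d <-> i = j.
Proof.
case=> [k|k1 l1 k2 l2 w1 w2 {}i e1 e2 w12 Li iW iw1 iw2];
  case=> [k'|k3 l3 k4 l4 w3 w4 {}j e3 e4 w34 Lj jW jw3 jw4].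
- by split=> [kk'|/val_inj //]; congr val; exact: kk'.
- by split=> // e; case: (proper_val k) => _; rewrite e.
- by split=> // e; case: (proper_val k') => _; rewrite -e.
have on_i (k l : iline M) w (klw : encodes k l w) :=
  encodes_seen_collinear Li iW iw1 iw2 w12 e1 e2 klw.
split.
  move=> [/sat_seen_collinear/(on_i _ _ _ e3) iw3].
  move=> /sat_seen_collinear/(on_i _ _ _ e4) iw4.
  exact: line_eq Li Lj w34 iw3 iw4 jw3 jw4.
move=> ij; rewrite -ij in jw3 jw4; split; apply/sat_seen_collinear.
  exact/(on_i _ _ _ e3).
exact/(on_i _ _ _ e4).
Qed.

Lemma inc_relP (c d : code M) s j : denotes_pt c s -> denotes_ln d j ->
  holds2 (inc_rel recovery) c d <-> j s.
Proof.
case=> [p|k l w klw]; case=> [m|k1 l1 k2 l2 w1 w2 {}j e1 e2 w12 Lj jW jw1 jw2].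
- by [].
- by split=> [[]|/jW/(@proper_point_val p)[]].
- apply: (iff_trans _ (encodes_pencil klw (proper_val m))).
  exact: (@sat_in_pencil [:: Ln; Ln; Ln] x0 x1 x2 (k, (l, (m, tt)))).
apply: (iff_trans _ (encodes_seen_collinear Lj jW jw1 jw2 w12 e1 e2 klw)).
exact: (@sat_seen_collinear [:: Ln; Ln; Ln; Ln; Ln; Ln] x2 x3 x4 x5 x0 x1
  (k, (l, (k1, (l1, (k2, (l2, tt))))))).
Qed.

Lemma set_relP (c : code M) s : denotes_pt c s -> holds1 (set_rel recovery) c <-> W s.
Proof.
case=> [p|k l w [_ Ww _ _]]; first by split=> // /(@proper_point_val p).
by split=> // _ [].
Qed.

Lemma denotes_pt_onto s : exists c : code M, denotes_pt c s.
Proof.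
have [/encodes_exists[k [l klw]]|nWs] := pselect (W s).
  by eexists; exact: DenotesImproperPoint klw.
have [p <-] := proper_point_ex nWs.
by eexists; exact: DenotesProperPoint.
Qed.

Lemma denotes_ln_onto j : L j -> exists c : code M, denotes_ln c j.
Proof.
move=> Lj; have [jW|njW] := pselect (j `<=` W); last first.
  have pj : proper_lines L W j by [].
  by have [k <-] := proper_line_ex pj; eexists; exact: DenotesProperLine.
have two : (1 < 2 * lambda + 2)%N by rewrite addn2.
have [w1 jw1 _] := line_not_covered Lj (card_ge0 S `I_1) two.
have [w2 jw2 w21] := line_not_covered Lj (card_set1_le w1) two.
have [k1 [l1 e1]] := encodes_exists (jW _ jw1).
have [k2 [l2 e2]] := encodes_exists (jW _ jw2).
have w12 : w1 <> w2 by move=> e; apply: w21; rewrite e.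
by eexists; exact: DenotesImproperLine e1 e2 w12 Lj jW jw1 jw2.
Qed.

Lemma denotes_ln_line (c : code M) j : denotes_ln c j -> L j.
Proof. by case=> // k; case: (proper_val k). Qed.

Lemma recovery_recovers : recovers recovery L W.
Proof.
have [s0 _] := exists_proper_point.
have [phi phiP] := choose_on s0 (fun c : code M => (pt_codesP c).1).
have [psi psiP] := choose_on set0 (fun c : code M => (ln_codesP c).1).
have phiE (c : code M) s : denotes_pt c s -> pt_codes recovery M c /\ phi c = s.
  move=> cs; have Dc : pt_codes recovery M c by apply/pt_codesP; exists s.
  by split=> //; apply/(pt_eqvP (phiP c Dc) cs)/(pt_eqvP cs cs).
have psiE (c : code M) j : denotes_ln c j -> ln_codes recovery M c /\ psi c = j.
  move=> cj; have Dc : ln_codes recovery M c by apply/ln_codesP; exists j.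
  by split=> //; apply/(ln_eqvP (psiP c Dc) cj)/(ln_eqvP cj cj).
exists phi, psi; split; [split|].
- apply/seteqP; split=> // s _.
  by have [c /phiE[Dc <-]] := denotes_pt_onto s; exists c.
- apply/seteqP; split=> [_ [c Dc <-]|j Lj].
    exact: denotes_ln_line (psiP c Dc).
  by have [c /psiE[Dc <-]] := denotes_ln_onto Lj; exists c.
split; first by move=> c d Dc Dd; exact: pt_eqvP (phiP c Dc) (phiP d Dd).
split; first by move=> c d Dc Dd; exact: ln_eqvP (psiP c Dc) (psiP d Dd).
split; first by move=> c d Dc Dd; exact: inc_relP (phiP c Dc) (psiP d Dd).
split; first by move=> c Dc; exact: set_relP (phiP c Dc).
split; first by move=> p; apply: phiE; exact: DenotesProperPoint.
by move=> k; apply: psiE; exact: DenotesProperLine.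
Qed.

End Recovery.

Theorem theorem3p1 :
  exists I : interpretation,
    forall (S : Type) (L : set (set S)) (W : set S) (lambda : nat),
      projective_space L ->
      dim_at_least L 3 ->
      has_index L W lambda ->
      (0 < lambda)%N ->
      (forall k : set S, L k -> `I_(2 * lambda + 2) #<= k) ->
      recovers I L W.
Proof.
exists recovery => S L W lambda projL dim3 indexW lambda_gt0 thick.
exact: recovery_recovers projL dim3 indexW lambda_gt0 thick.
Qed.
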